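(* Let $n\ge 2$, $b_i>0$, $\alpha_i>0$ for $i=1,\dots,n$ with $\alpha_i\ne\alpha_{i+1}$ for all $i$, and let $g(t)=\sum_{i=1}^n b_ie^{-\alpha_i t}$. Then $$\dot g(t)^2-g(t)\ddot g(t)<0\quad\text{for all } t\ge 0.$$ Consequently, $g\,\mathds{1}_{[0,\infty)}$ is nonnegative but not log-concave; in particular, strongly unimodal LTI systems are not closed under parallel interconnection.
   Context: A function $f:\mathbb{R}\to\mathbb{R}_{\ge0}$ is log-concave if $f(\lambda x+(1-\lambda)y)\ge f(x)^\lambda f(y)^{1-\lambda}$ for all $x,y\in\mathbb{R}$ and $\lambda\in[0,1]$. A causal LTI system with impulse response $g$ maps $u$ to $g\ast u$, $(g\ast u)(t)=\int g(t-\tau)u(\tau)d\tau$; it is strongly unimodal if it maps every quasi-concave (unimodal) function to a quasi-concave function, where $f$ is quasi-concave if $f(\lambda x+(1-\lambda)y)\ge\min\{f(x),f(y)\}$. The parallel interconnection of systems with impulse responses $g_1,g_2$ has impulse response $g_1+g_2$; each first-order system with impulse response $b_ie^{-\alpha_i t}\mathds{1}_{[0,\infty)}$, $b_i,\alpha_i>0$, is strongly unimodal. *)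

(* Defs.v *)
From Stdlib Require Import Reals.
From Coquelicot Require Export Coquelicot.
Open Scope R_scope.

Definition rpow (x y : R) : R :=
  if Req_EM_T x 0 then (if Req_EM_T y 0 then 1 else 0) else Rpower x y.

Definition log_concave (f : R -> R) : Prop :=
  (forall x, 0 <= f x) /\
  forall x y lam, 0 <= lam <= 1 ->
    f (lam * x + (1 - lam) * y) >= rpow (f x) lam * rpow (f y) (1 - lam).

Definition causal (g : R -> R) : R -> R :=
  fun t => if Rle_dec 0 t then g t else 0.

(* g(t) = sum_{i=0}^{n-1} b_i e^{-a_i t}  (0-based indices) *)
Definition expsum (n : nat) (b a : nat -> R) : R -> R :=
  fun t => sum_f_R0 (fun i => b i * exp (- a i * t)) (n - 1).

(* Main.v *)
(** The terms [w_i = b_i e^(-a_i t)] are positive weights, and in terms of them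
    [g = sum w_i], [g' = - sum a_i w_i], [g'' = sum a_i^2 w_i]; so [g g'' - g'^2]
    is the Lagrange expression [sum_(i<j) w_i w_j (a_i - a_j)^2] of the
    Cauchy-Schwarz inequality, which is positive as soon as two of the exponents
    differ.  The same inequality, with weights [b_i] and values [e^(-a_i)], gives
    [g(0) g(2) > g(1)^2], whereas log-concavity at the midpoint [1] of [0] and [2]
    forces [g(0) g(2) <= g(1)^2]. *)

Require Import Defs.
From Stdlib Require Import Reals Lra Lia Psatz.
From Coquelicot Require Import Coquelicot.
Open Scope R_scope.

Lemma sum_weighted_sq_dev (w u : nat -> R) (c : R) (m : nat) :
  sum_f_R0 (fun i => w i * (u i - c) ^ 2) m =
  sum_f_R0 (fun i => w i * u i ^ 2) m - 2 * c * sum_f_R0 (fun i => w i * u i) m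
  + c ^ 2 * sum_f_R0 w m.
Proof. induction m as [|m IH]; [simpl | rewrite !tech5, IH]; ring. Qed.

Lemma weighted_Cauchy_Schwarz_strict (w u : nat -> R) (m : nat) :
  (1 <= m)%nat ->
  (forall i, (i <= m)%nat -> 0 <= w i) ->
  0 < w 0%nat -> 0 < w 1%nat -> u 0%nat <> u 1%nat ->
  (sum_f_R0 (fun i => w i * u i) m) ^ 2
    < sum_f_R0 w m * sum_f_R0 (fun i => w i * u i ^ 2) m.
Proof.
  intros Hm Hw Hw0 Hw1 Hu.
  induction Hm as [|m Hm IH].
  - simpl.
    assert (0 < (u 0%nat - u 1%nat) ^ 2) by (apply pow2_gt_0; lra).
    assert (0 < w 0%nat * w 1%nat * (u 0%nat - u 1%nat) ^ 2)
      by (apply Rmult_lt_0_compat; nra).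
    nra.
  - assert (Hdev : 0 <= sum_f_R0 (fun i => w i * (u i - u (S m)) ^ 2) m).
    { rewrite <- (Rmult_0_l (INR (S m))), <- sum_cte.
      apply sum_Rle; intros i Hi.
      apply Rmult_le_pos; [apply Hw; lia | apply pow2_ge_0]. }
    rewrite sum_weighted_sq_dev in Hdev.
    assert (Hnew : 0 <= w (S m)) by (apply Hw; lia).
    specialize (IH (fun i Hi => Hw i (le_S _ _ Hi))).
    rewrite !tech5.
    (* The defect grows by [w_(m+1) * sum_(i<=m) w_i (u_i - u_(m+1))^2]. *)
    nra.
Qed.

Lemma is_derive_expsum (n : nat) (b a : nat -> R) (t : R) :
  is_derive (expsum n b a) t (expsum n (fun i => - a i * b i) a t).
Proof.
  unfold expsum; induction (n - 1)%nat as [|m IH]; simpl.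
  - auto_derive; [exact I | ring].
  - apply (is_derive_plus (fun t => sum_f_R0 (fun i => b i * exp (- a i * t)) m)
             (fun t => b (S m) * exp (- a (S m) * t))); [exact IH|].
    auto_derive; [exact I | ring].
Qed.

Lemma Derive_expsum (n : nat) (b a : nat -> R) (t : R) :
  Derive (expsum n b a) t = expsum n (fun i => - a i * b i) a t.
Proof. apply is_derive_unique, is_derive_expsum. Qed.

Lemma Derive2_expsum (n : nat) (b a : nat -> R) (t : R) :
  Derive (Derive (expsum n b a)) t = expsum n (fun i => - a i * (- a i * b i)) a t.
Proof. rewrite (Derive_ext _ _ t (Derive_expsum n b a)); apply Derive_expsum. Qed.

Lemma expsum_pos (n : nat) (b a : nat -> R) (t : R) :
  (0 < n)%nat -> (forall i, (i < n)%nat -> 0 < b i) -> 0 < expsum n b a t.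
Proof.
  intros Hn Hb; apply tech1; intros i Hi.
  apply Rmult_lt_0_compat; [apply Hb; lia | apply exp_pos].
Qed.

Lemma expsum_sq_Derive_lt (n : nat) (b a : nat -> R) (t : R) :
  (2 <= n)%nat -> (forall i, (i < n)%nat -> 0 < b i) -> a 0%nat <> a 1%nat ->
  (Derive (expsum n b a) t) ^ 2 < expsum n b a t * Derive (Derive (expsum n b a)) t.
Proof.
  intros Hn Hb Ha.
  set (w := fun i => b i * exp (- a i * t)).
  assert (Hw : forall i, (i < n)%nat -> 0 < w i)
    by (intros i Hi; apply Rmult_lt_0_compat; [apply Hb; lia | apply exp_pos]).
  rewrite Derive2_expsum, Derive_expsum; unfold expsum.
  rewrite (sum_eq (fun i => - a i * b i * _) (fun i => w i * (- a i)))
    by (intros; unfold w; ring).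
  rewrite (sum_eq (fun i => - a i * (- a i * b i) * _) (fun i => w i * (- a i) ^ 2))
    by (intros; unfold w; ring).
  apply (weighted_Cauchy_Schwarz_strict w (fun i => - a i)).
  - lia.
  - intros i Hi; apply Rlt_le, Hw; lia.
  - apply Hw; lia.
  - apply Hw; lia.
  - lra.
Qed.

Lemma rpow_half (x : R) : 0 <= x -> rpow x (/ 2) = sqrt x.
Proof.
  intros Hx; unfold rpow.
  destruct (Req_EM_T x 0) as [->|Hx0]; [|apply Rpower_sqrt; lra].
  destruct (Req_EM_T (/ 2) 0); [lra | now rewrite sqrt_0].
Qed.

Lemma log_concave_midpoint (f : R -> R) (x y : R) :
  log_concave f -> f x * f y <= f ((x + y) / 2) ^ 2.
Proof.
  intros [Hf Hlc].
  specialize (Hlc x y (/ 2) ltac:(lra)).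
  replace (/ 2 * x + (1 - / 2) * y) with ((x + y) / 2) in Hlc by field.
  replace (1 - / 2) with (/ 2) in Hlc by field.
  rewrite !rpow_half, <- sqrt_mult in Hlc by apply Hf.
  rewrite <- (sqrt_sqrt (f x * f y)) by (apply Rmult_le_pos; apply Hf).
  assert (0 <= sqrt (f x * f y)) by apply sqrt_pos.
  nra.
Qed.

Lemma expsum_midpoint_sq_lt (n : nat) (b a : nat -> R) :
  (2 <= n)%nat -> (forall i, (i < n)%nat -> 0 < b i) -> a 0%nat <> a 1%nat ->
  expsum n b a 1 ^ 2 < expsum n b a 0 * expsum n b a 2.
Proof.
  intros Hn Hb Ha.
  set (u := fun i => exp (- a i)).
  unfold expsum.
  rewrite (sum_eq (fun i => b i * exp (- a i * 0)) b)
    by (intros; rewrite Rmult_0_r, exp_0; ring).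
  rewrite (sum_eq (fun i => b i * exp (- a i * 1)) (fun i => b i * u i))
    by (intros; unfold u; rewrite Rmult_1_r; ring).
  rewrite (sum_eq (fun i => b i * exp (- a i * 2)) (fun i => b i * u i ^ 2)).
  2: { intros; unfold u.
       replace (- a i * 2) with (- a i + - a i) by ring; rewrite exp_plus; ring. }
  apply weighted_Cauchy_Schwarz_strict.
  - lia.
  - intros i Hi; apply Rlt_le, Hb; lia.
  - apply Hb; lia.
  - apply Hb; lia.
  - intros E; apply exp_inv in E; lra.
Qed.

Theorem lemma6 (n : nat) (b a : nat -> R) :
  (2 <= n)%nat ->
  (forall i, (i < n)%nat -> 0 < b i) ->
  (forall i, (i < n)%nat -> 0 < a i) ->
  (forall i, (i + 1 < n)%nat -> a i <> a (i + 1)%nat) ->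
  (forall t, 0 <= t ->
     (Derive (expsum n b a) t) ^ 2
       - expsum n b a t * Derive (Derive (expsum n b a)) t < 0) /\
  (forall t, 0 <= causal (expsum n b a) t) /\
  ~ log_concave (causal (expsum n b a)).
Proof.
  intros Hn Hb _ Hd.
  assert (Ha01 : a 0%nat <> a 1%nat) by (apply (Hd 0%nat); lia).
  assert (Hg : forall t, 0 < expsum n b a t) by (intro; apply expsum_pos; [lia | exact Hb]).
  assert (Hcausal : forall t, 0 <= t -> causal (expsum n b a) t = expsum n b a t)
    by (intros t Ht; unfold causal; destruct (Rle_dec 0 t); [reflexivity | lra]).
  split; [|split].
  - intros t _.
    pose proof (expsum_sq_Derive_lt n b a t Hn Hb Ha01); lra.
  - intro t; unfold causal; destruct (Rle_dec 0 t); [apply Rlt_le, Hg | lra].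
  - intros Hlc.
    pose proof (log_concave_midpoint _ 0 2 Hlc) as Hmid.
    replace ((0 + 2) / 2) with 1 in Hmid by field.
    rewrite !Hcausal in Hmid by lra.
    pose proof (expsum_midpoint_sq_lt n b a Hn Hb Ha01); lra.
Qed.
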